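(* The complex $(\mathfrak{A}_*,\delta)$ is isomorphic to a direct sum of simplicial chain complexes: $$(\mathfrak{A}_*,\delta)\;\cong\;\bigoplus_{i\ge 0}\ \bigoplus_{\mathcal{L}\in\mathscr{E}_i} C_*(\Delta_+).$$
   Context: All vector spaces are over $\mathbb{Q}$. For $q\ge 0$, $\mathfrak{A}_q$ is the $\mathbb{Q}$-vector space with basis the symbols $b_\Lambda$, where $\Lambda$ ranges over the nonempty finite sets of $q$-element subsets of $\mathbb{Z}_{>0}$ (it arises as a direct limit of relative atomic complexes of $k$-equal arrangements). $\mathfrak{A}_*=\bigoplus_{q\ge0}\mathfrak{A}_q$; $\mathfrak{A}_0$ is spanned by $b_\emptyset$, meaning $b_\Lambda$ with $\Lambda=\{\emptyset\}$. Write $\bigcap\Lambda$ for the intersection of the members of $\Lambda$ and $\hat\Lambda=\{\lambda\setminus\bigcap\Lambda : \lambda\in\Lambda\}$. The family $\Lambda$ is determined by the pair $(\bigcap\Lambda,\hat\Lambda)$, and one writes $b_\Lambda=b_{(\cap\Lambda,\hat\Lambda)}$. The map $\delta:\mathfrak{A}_q\to\mathfrak{A}_{q-1}$ is defined by $$\delta\, b_{(\cap\Lambda,\hat\Lambda)}=\sum_{i=1}^{t}(-1)^i\, b_{(\cap\Lambda\setminus\{\ell_i\},\hat\Lambda)},\qquad \bigcap\Lambda=\{\ell_1<\dots<\ell_t\}.$$ $\mathscr{E}_i$ denotes the set of finite nonempty collections $\mathcal{L}$ of $i$-element subsets of $\mathbb{Z}_{>0}$ such that $\bigcap\mathcal{L}=\emptyset$;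 for $i=0$ the only such collection is $\{\emptyset\}$. $\Delta_+$ is the standard infinite-dimensional simplex on vertex set $\mathbb{Z}_{>0}$ (simplices are finite subsets), with the empty set included as a $(-1)$-simplex, and $C_*(\Delta_+)$ is its (augmented) simplicial chain complex over $\mathbb{Q}$. Isomorphism of complexes means a linear isomorphism commuting with the differentials; degree shifts on the summands are not indicated. *)

(* Defs.v *)
From HB Require Import structures.
From mathcomp Require Import all_boot all_order all_algebra finmap.
From mathcomp Require Import boolp.
From mathcomp Require Import monalg.
From mathcomp Require Import zify.

Set Implicit Arguments.
Unset Strict Implicit.
Unset Printing Implicit Defensive.

Import GRing.Theory.
Local Open Scope fset_scope.
Local Open Scope ring_scope.

(* The differential is indexed by its source and target degrees and vanishes
   unless it lowers the degree by one; this makes degree shifts definitional. *)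
Record chainComplex := ChainComplex {
  cobj : int -> lmodType rat;
  cdiff : forall m n : int, {linear cobj m -> cobj n};
  cdiff_shape : forall (m n : int) x, m != n + 1 -> cdiff m n x = 0;
  cdiffK : forall (m n p : int) x, cdiff n p (cdiff m n x) = 0 }.

Definition complex_iso (C D : chainComplex) : Prop :=
  exists f : forall n : int, {linear cobj C n -> cobj D n},
    (forall n, bijective (f n)) /\
    (forall m n (x : cobj C m), f n (cdiff C m n x) = cdiff D m n (f m x)).

(* The part of degree n of [shiftC C s] is the part of degree n - s of C; no
   sign is introduced in the differential. *)
Section Shift.
Variables (C : chainComplex) (s : int).

Lemma shift_shape (m n : int) (x : cobj C (m - s)) :
  m != n + 1 -> cdiff C (m - s) (n - s) x = 0.
Proof. by move=> h; apply: cdiff_shape; apply: contra h => /eqP h; lia. Qed.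

Definition shiftC : chainComplex :=
  @ChainComplex (fun n => cobj C (n - s))
    (fun m n => cdiff C (m - s) (n - s))
    shift_shape (fun m n p => @cdiffK C (m - s) (n - s) (p - s)).

End Shift.

Section DirectSum.
Variables (I : choiceType) (V : I -> lmodType rat).

Record dsum := DSum {
  dsum_val :> forall i, V i;
  dsum_fin : exists s : seq I, forall i, i \notin s -> dsum_val i = 0 }.

Lemma dsumP (u v : dsum) : (forall i, u i = v i) -> u = v.
Proof.
case: u v => [u hu] [v hv] /= uv.
have {}uv : u = v by apply: functional_extensionality_dep.
by subst v; congr DSum; apply: Prop_irrelevance.
Qed.

HB.instance Definition _ := gen_eqMixin dsum.
HB.instance Definition _ := gen_choiceMixin dsum.

Lemma dsum0_fin : exists s : seq I, forall i, i \notin s -> (0 : V i) = 0.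
Proof. by exists [::]. Qed.

Lemma dsumN_fin (u : dsum) :
  exists s : seq I, forall i, i \notin s -> - u i = 0.
Proof. by case: (dsum_fin u) => s hs; exists s => i /hs ->; rewrite oppr0. Qed.

Lemma dsumD_fin (u v : dsum) :
  exists s : seq I, forall i, i \notin s -> u i + v i = 0.
Proof.
case: (dsum_fin u) (dsum_fin v) => s hs [t ht]; exists (s ++ t) => i.
by rewrite mem_cat negb_or => /andP[/hs -> /ht ->]; rewrite addr0.
Qed.

Lemma dsumZ_fin a (u : dsum) :
  exists s : seq I, forall i, i \notin s -> a *: u i = 0.
Proof. by case: (dsum_fin u) => s hs; exists s => i /hs ->; rewrite scaler0. Qed.

Definition dsum0 := DSum dsum0_fin.
Definition dsumN u := DSum (dsumN_fin u).
Definition dsumD u v := DSum (dsumD_fin u v).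
Definition dsumZ a u := DSum (dsumZ_fin a u).

Fact dsumA : associative dsumD.
Proof. by move=> u v w; apply: dsumP => i /=; rewrite addrA. Qed.
Fact dsumC : commutative dsumD.
Proof. by move=> u v; apply: dsumP => i /=; rewrite addrC. Qed.
Fact dsum0D : left_id dsum0 dsumD.
Proof. by move=> u; apply: dsumP => i /=; rewrite add0r. Qed.
Fact dsumND : left_inverse dsum0 dsumN dsumD.
Proof. by move=> u; apply: dsumP => i /=; rewrite addNr. Qed.

HB.instance Definition _ := GRing.isZmodule.Build dsum dsumA dsumC dsum0D dsumND.

Fact dsumZA a b u : dsumZ a (dsumZ b u) = dsumZ (a * b) u.
Proof. by apply: dsumP => i /=; rewrite scalerA. Qed.
Fact dsum1Z : left_id 1 dsumZ.
Proof. by move=> u; apply: dsumP => i /=; rewrite scale1r. Qed.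
Fact dsumZDr : right_distributive dsumZ +%R.
Proof. by move=> a u v; apply: dsumP => i /=; rewrite scalerDr. Qed.
Fact dsumZDl u : {morph dsumZ^~ u : a b / a + b}.
Proof. by move=> a b; apply: dsumP => i /=; rewrite scalerDl. Qed.

HB.instance Definition _ := GRing.Zmodule_isLmodule.Build rat dsum
  dsumZA dsum1Z dsumZDr dsumZDl.

End DirectSum.

Section DirectSumMap.
Variables (I : choiceType) (V W : I -> lmodType rat).
Variable f : forall i, {linear V i -> W i}.

Lemma dsum_map_fin (u : dsum V) :
  exists s : seq I, forall i, i \notin s -> f i (u i) = 0.
Proof. by case: (dsum_fin u) => s hs; exists s => i /hs ->; rewrite linear0. Qed.

Definition dsum_map (u : dsum V) : dsum W := DSum (dsum_map_fin u).

Fact dsum_map_linear : linear dsum_map.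
Proof. by move=> a u v; apply: dsumP => i /=; rewrite linearP. Qed.

HB.instance Definition _ :=
  GRing.isLinear.Build rat (dsum V) (dsum W) *:%R dsum_map dsum_map_linear.

End DirectSumMap.

Section DirectSumComplex.
Variables (I : choiceType) (C : I -> chainComplex).

Let obj (n : int) : lmodType rat := dsum (fun i => cobj (C i) n).
Let diff (m n : int) : {linear obj m -> obj n} :=
  dsum_map (fun i => cdiff (C i) m n).

Lemma dsum_shape (m n : int) (x : obj m) : m != n + 1 -> diff m n x = 0.
Proof. by move=> h; apply: dsumP => i /=; apply: cdiff_shape. Qed.

Lemma dsum_diffK (m n p : int) (x : obj m) : diff n p (diff m n x) = 0.
Proof. by apply: dsumP => i /=; apply: cdiffK. Qed.

Definition dsum_complex : chainComplex := ChainComplex dsum_shape dsum_diffK.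

End DirectSumComplex.

(* {malg rat[K]} is the vector space with basis K. *)
Section LinearExtension.
Variables (K : choiceType) (V : lmodType rat) (f : K -> V).

Definition lin_ext (g : {malg rat[K]}) : V := \sum_(k <- msupp g) g@_k *: f k.

Lemma lin_extEw (A : {fset K}) (g : {malg rat[K]}) :
  msupp g `<=` A -> lin_ext g = \sum_(k <- A) g@_k *: f k.
Proof.
move=> sA; rewrite /lin_ext; apply: big_fset_incl => // k _.
by rewrite -mcoeff_eq0 => /eqP ->; rewrite scale0r.
Qed.

Fact lin_ext_linear : linear lin_ext.
Proof.
move=> a g h; pose A := msupp g `|` msupp h.
have sA : msupp (a *: g + h) `<=` A.
  by apply: fsubset_trans (msuppD_le _ _) _; apply: fsetSU; apply: msuppZ_le.
rewrite (lin_extEw sA) (@lin_extEw A g) ?fsubsetUl //.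
rewrite (@lin_extEw A h) ?fsubsetUr // scaler_sumr -big_split /=.
by apply: eq_bigr => k _; rewrite mcoeffD mcoeffZ scalerDl scalerA.
Qed.

HB.instance Definition _ :=
  GRing.isLinear.Build rat {malg rat[K]} V *:%R lin_ext lin_ext_linear.

Lemma lin_extU k : lin_ext << k >> = f k.
Proof. by rewrite /lin_ext msuppU oner_eq0 big_seq_fset1 mcoeffUU scale1r. Qed.

End LinearExtension.

(* The vector space with basis the elements of T satisfying P; [basis_vec P x]
   is the basis vector at x if P x holds, and 0 otherwise. *)
Section FreeOn.
Variables (T : choiceType) (P : pred T).

Definition free_on : lmodType rat := {malg rat[{x : T | P x}]}.

Definition basis_vec (x : T) : free_on :=
  if insub x is Some u then << u >> else 0.

Lemma basis_vec0 x : ~~ P x -> basis_vec x = 0.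
Proof. by move=> h; rewrite /basis_vec insubN. Qed.

Lemma lin_ext_basis_vec (V : lmodType rat) (f : T -> V) x :
  P x -> lin_ext (fun u : {x | P x} => f (val u)) (basis_vec x) = f x.
Proof.
by move=> Px; rewrite /basis_vec; case: insubP => [u _ <-|/negP//]; rewrite lin_extU.
Qed.

Lemma free_on_ext0 (V : lmodType rat) (f : T -> V) (g : free_on) :
  (forall x, P x -> f x = 0) -> lin_ext (fun u : {x | P x} => f (val u)) g = 0.
Proof.
move=> h; rewrite /lin_ext big1 // => u _.
by rewrite h ?scaler0 //; apply: valP.
Qed.

Lemma lin_extK (V W : lmodType rat) (f : T -> V) (h : {linear V -> W}) g :
  (forall x, P x -> h (f x) = 0) ->
  h (lin_ext (fun u : {x | P x} => f (val u)) g) = 0.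
Proof.
move=> hf; rewrite /lin_ext linear_sum big1 // => u _.
by rewrite linearZ /= hf ?scaler0 //; apply: valP.
Qed.

End FreeOn.

(* The vertex set, the positive integers. *)
Definition pnat := {n : nat | (0 < n)%N}.

(* [rank S x] is the position of x in the increasing enumeration of S, counted
   from 0. *)
Definition rank (S : {fset pnat}) (x : pnat) : nat :=
  #|` [fset y in S | (val y < val x)%N] |.

Section AlternatingSums.
Variables (V : lmodType rat) (g : {fset pnat} -> V).

Lemma rankD1_lt (S : {fset pnat}) (x y : pnat) : x \in S ->
  (val x < val y)%N -> rank S y = (rank (S `\ x) y).+1.
Proof.
move=> xS xy; rewrite /rank (cardfsD1 x) !inE xS xy /= add1n; congr (_.+1).
by congr (#|` _ |); apply/fsetP => z; rewrite !inE andbA.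
Qed.

Lemma rankD1_gt (S : {fset pnat}) (x y : pnat) :
  (val y < val x)%N -> rank (S `\ x) y = rank S y.
Proof.
move=> yx; rewrite /rank; congr (#|` _ |); apply/fsetP => z; rewrite !inE.
by case: eqP => //= ->; rewrite ltnNge (ltnW yx) andbF.
Qed.

Lemma alternating_sumK (S : {fset pnat}) :
  \sum_(x <- S) (-1) ^+ rank S x *:
    (\sum_(y <- S `\ x) (-1) ^+ rank (S `\ x) y *: g (S `\ x `\ y)) = 0.
Proof.
pose F x y : V :=
  if x == y then 0 else
  ((-1) ^+ rank S x * (-1) ^+ rank (S `\ x) y) *: g (S `\ x `\ y).
have Fanti x y : x \in S -> y \in S -> F x y = - F y x.
  have lt_case (a b : pnat) :
      a \in S -> (val a < val b)%N -> F a b = - F b a.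
    move=> aS ab; rewrite /F.
    have /negbTE nab : a != b by apply: contraTneq ab => ->; rewrite ltnn.
    rewrite nab eq_sym nab (rankD1_lt aS ab) (rankD1_gt S ab) -scaleNr.
    rewrite !fsetDDl [[fset a] `|` _]fsetUC; congr (_ *: _).
    by rewrite exprS mulN1r mulNr opprK mulrC.
  move=> xS yS; case: (ltngtP (val x) (val y)) => [xy|yx|/val_inj ->].
  - exact: lt_case.
  - by rewrite (lt_case _ _ yS yx) opprK.
  - by rewrite /F eqxx oppr0.
set X := LHS.
have XE : X = \sum_(x <- S) \sum_(y <- S) F x y.
  rewrite /X big_seq [RHS]big_seq; apply: eq_bigr => x xS.
  rewrite [RHS](big_fsetD1 x) //= {1}/F eqxx add0r scaler_sumr.
  rewrite big_seq [RHS]big_seq; apply: eq_bigr => y; rewrite !inE => /andP[yx _].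
  by rewrite /F eq_sym (negbTE yx) scalerA.
have XN : X = - X.
  rewrite {1}XE exchange_big /= XE -sumrN big_seq [RHS]big_seq.
  apply: eq_bigr => x xS; rewrite -sumrN big_seq [RHS]big_seq.
  by apply: eq_bigr => y yS; apply: Fanti.
have : 2%:R *: X == 0 by rewrite scaler_nat mulr2n {2}XN subrr.
by rewrite scaler_eq0 /= => /eqP.
Qed.

End AlternatingSums.

Section SimplexComplex.

(* Augmented simplicial chains on all finite sets of vertices; a simplex of
   dimension n has n + 1 vertices, and the empty simplex has dimension -1. *)
Definition is_simplex (n : int) (s : {fset pnat}) : bool :=
  (#|` s|%:Z == n + 1).

Definition simplex_boundary (n : int) (s : {fset pnat}) : free_on (is_simplex n) :=
  \sum_(x <- s) (-1) ^+ rank s x *: basis_vec (is_simplex n) (s `\ x).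

Let obj (n : int) : lmodType rat := free_on (is_simplex n).
Let diff (m n : int) : {linear obj m -> obj n} :=
  lin_ext (fun u : {s | is_simplex m s} => simplex_boundary n (val u)).

Lemma simplex_shape (m n : int) (x : obj m) : m != n + 1 -> diff m n x = 0.
Proof.
move=> mn; apply: free_on_ext0 => s /eqP sm.
rewrite /simplex_boundary big_seq big1 // => y ys.
rewrite basis_vec0 ?scaler0 //; apply: contra mn => /eqP.
by move: sm; rewrite (cardfsD1 y) ys => h1 h2; lia.
Qed.

Lemma simplex_boundaryK (m n p : int) (x : obj m) : diff n p (diff m n x) = 0.
Proof.
have [mn|/simplex_shape ->] := eqVneq m (n + 1); last exact: linear0.
apply: lin_extK => s /eqP sm.
transitivity (\sum_(a <- s) (-1) ^+ rank s a *: simplex_boundary p (s `\ a)).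
  rewrite /simplex_boundary linear_sum big_seq [RHS]big_seq.
  apply: eq_bigr => a sa; rewrite linearZ /=; congr (_ *: _).
  apply: (lin_ext_basis_vec (simplex_boundary p)).
  by apply/eqP; move: sm; rewrite (cardfsD1 a) sa; lia.
exact: (alternating_sumK (basis_vec (is_simplex p))).
Qed.

Definition simplex_complex : chainComplex :=
  ChainComplex simplex_shape simplex_boundaryK.

End SimplexComplex.

Section Families.

Implicit Types (L H : {fset {fset pnat}}) (l h S : {fset pnat}) (x : pnat).

Definition core (L : {fset {fset pnat}}) : {fset pnat} :=
  [fset x in \bigcup_(l <- L) l | all (fun l : {fset pnat} => x \in l) L].

Definition hat (L : {fset {fset pnat}}) : {fset {fset pnat}} :=
  [fset l `\` core L | l in L].

(* The family with intersection S and associated reduced family H. *)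
Definition family_of (S : {fset pnat}) (H : {fset {fset pnat}}) :
    {fset {fset pnat}} :=
  [fset S `|` h | h in H].

Definition uniform (q : int) (L : {fset {fset pnat}}) : bool :=
  all (fun l => #|` l|%:Z == q) L.

Lemma coreP L x : L != fset0 ->
  reflect (forall l, l \in L -> x \in l) (x \in core L).
Proof.
move=> L0; rewrite !inE; apply: (iffP andP) => [[_ /allP //]|h].
split; last exact/allP.
case/fset0Pn: L0 => l0 l0L.
by apply/bigfcupP; exists l0; rewrite ?l0L ?h.
Qed.

Lemma core_sub L l : l \in L -> core L `<=` l.
Proof.
move=> lL; have L0 : L != fset0 by apply/fset0Pn; exists l.
by apply/fsubsetP => x /(coreP _ L0); apply.
Qed.

Lemma family_of_neq0 S H : H != fset0 -> family_of S H != fset0.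
Proof.
by case/fset0Pn => h hH; apply/fset0Pn; exists (S `|` h); apply: in_imfset.
Qed.

Lemma hat_neq0 L : L != fset0 -> hat L != fset0.
Proof.
by case/fset0Pn => l lL; apply/fset0Pn; exists (l `\` core L); apply: in_imfset.
Qed.

Lemma family_of_core_hat L : family_of (core L) (hat L) = L.
Proof.
apply/fsetP => l; apply/imfsetP/idP => /= [[h /imfsetP[/= k kL ->] ->]|lL].
  by rewrite fsetUDl fsetDv fsetD0 (fsetUidPr _ _ (core_sub kL)).
exists (l `\` core L); first exact: in_imfset.
by rewrite fsetUDl fsetDv fsetD0 (fsetUidPr _ _ (core_sub lL)).
Qed.

Lemma core_family_of L S : L != fset0 -> S `<=` core L ->
  core (family_of S (hat L)) = S.
Proof.
move=> L0 sS; have F0 := family_of_neq0 S (hat_neq0 L0).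
apply/fsetP => x; apply/(coreP _ F0)/idP => [h|xS l /imfsetP[/= h _ ->]].
  apply: contraT => xS.
  have hL l : l \in L -> x \in l `\` core L.
    move=> lL; have : x \in S `|` (l `\` core L).
      by apply: h; apply: in_imfset; apply: in_imfset.
    by rewrite inE (negbTE xS).
  have xc : x \in core L.
    by apply/(coreP _ L0) => l /hL; rewrite inE => /andP[].
  by case/fset0Pn: L0 => l /hL; rewrite inE xc.
by rewrite inE xS.
Qed.

Lemma hat_family_of L S : L != fset0 -> S `<=` core L ->
  hat (family_of S (hat L)) = hat L.
Proof.
move=> L0 sS; rewrite {1}/hat core_family_of //.
have hS h : h \in hat L -> (S `|` h) `\` S = h.
  case/imfsetP => /= l lL ->; rewrite fsetDUl fsetDv fset0U; apply/fsetP => x.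
  by rewrite !in_fsetD; case: (boolP (x \in S)) => //= xS; rewrite (fsubsetP sS _ xS).
apply/fsetP => h; apply/imfsetP/idP => /= [[_ /imfsetP[/= k kL ->] ->]|hL].
  by rewrite hS.
by exists (S `|` h); rewrite ?hS //; apply: in_imfset.
Qed.

Definition is_index (q : int) (L : {fset {fset pnat}}) : bool :=
  (L != fset0) && uniform q L.

(* The i-th element of core L has rank i - 1, hence the exponent. *)
Definition delta_basis (q : int) (L : {fset {fset pnat}}) :
    free_on (is_index q) :=
  \sum_(x <- core L) (-1) ^+ (rank (core L) x).+1 *:
    basis_vec (is_index q) (family_of (core L `\ x) (hat L)).

Let obj (q : int) : lmodType rat := free_on (is_index q).
Let diff (m n : int) : {linear obj m -> obj n} :=
  lin_ext (fun u : {L | is_index m L} => delta_basis n (val u)).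

Lemma card_family_of L l x : l \in L -> x \in core L ->
  #|` l| = #|` (core L `\ x) `|` (l `\` core L)|.+1.
Proof.
move=> lL xL; rewrite (cardfsD1 x).
have xl : x \in l by apply: (fsubsetP (core_sub lL)).
rewrite xl add1n; congr _.+1; congr (#|` _|); apply/fsetP => y.
rewrite in_fsetU !in_fsetD in_fset1; have := fsubsetP (core_sub lL) y.
case: (eqVneq y x) xL => [-> ->|_ _] //=.
by case: (y \in core L) => // ->.
Qed.

Lemma is_index_family_of (q : int) L x : x \in core L -> L != fset0 ->
  is_index q (family_of (core L `\ x) (hat L)) = is_index (q + 1) L.
Proof.
move=> xL L0; rewrite /is_index L0 family_of_neq0 ?hat_neq0 //=.
apply/allP/allP => /= h l.
  move=> lL; rewrite (card_family_of lL xL).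
  have /h/eqP : (core L `\ x) `|` (l `\` core L) \in
      family_of (core L `\ x) (hat L) by apply: in_imfset; apply: in_imfset.
  by rewrite intS addrC => ->.
case/imfsetP => /= _ /imfsetP[/= k kL ->] -> .
by move: (h _ kL); rewrite (card_family_of kL xL) intS addrC (inj_eq (addIr 1)).
Qed.

Lemma is_index_inj (m n : int) L : is_index m L -> is_index n L -> m = n.
Proof.
case/andP => /fset0Pn[l lL] /allP/(_ _ lL)/eqP <-.
by case/andP => _ /allP/(_ _ lL)/eqP <-.
Qed.

Lemma delta_shape (m n : int) (x : obj m) : m != n + 1 -> diff m n x = 0.
Proof.
move=> mn; apply: free_on_ext0 => L Lm; have /andP[L0 _] := Lm.
rewrite /delta_basis big_seq big1 // => y yL.
rewrite basis_vec0 ?scaler0 //; apply: contra mn.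
by rewrite is_index_family_of // => Ln; rewrite (is_index_inj Lm Ln).
Qed.

Lemma deltaK (m n p : int) (x : obj m) : diff n p (diff m n x) = 0.
Proof.
have [mn|/delta_shape ->] := eqVneq m (n + 1); last exact: linear0.
apply: lin_extK => L; rewrite mn => Lm; have /andP[L0 _] := Lm.
transitivity (\sum_(x <- core L) (-1) ^+ (rank (core L) x).+1 *:
    delta_basis p (family_of (core L `\ x) (hat L))).
  rewrite {1}/delta_basis linear_sum big_seq [RHS]big_seq.
  apply: eq_bigr => a aL; rewrite linearZ /=; congr (_ *: _).
  by apply: (lin_ext_basis_vec (delta_basis p)); rewrite is_index_family_of.
pose g S := basis_vec (is_index p) (family_of S (hat L)).
rewrite -[RHS](alternating_sumK g (core L)); apply: eq_bigr => /= a _.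
have sS : core L `\ a `<=` core L by apply: fsubsetDl.
rewrite /delta_basis (core_family_of L0 sS) (hat_family_of L0 sS).
rewrite exprS mulN1r scaleNr -scalerN -sumrN; congr (_ *: _).
by apply: eq_bigr => b _; rewrite exprS mulN1r scaleNr opprK.
Qed.

(* There is no q-element subset for q < 0, so this is zero in negative
   degrees. *)
Definition frakA : chainComplex := ChainComplex delta_shape deltaK.

Definition scrE (i : nat) : choiceType :=
  {L : {fset {fset pnat}} | [&& L != fset0, uniform i L & core L == fset0]}.

End Families.

(* Main.v *)
From HB Require Import structures.
Require Import Defs.
From mathcomp Require Import all_boot all_order all_algebra.
From mathcomp Require Import finmap boolp monalg zify.

Set Implicit Arguments.
Unset Strict Implicit.
Unset Printing Implicit Defensive.

Import Defs GRing.Theory.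
Local Open Scope fset_scope.
Local Open Scope ring_scope.

(** The differential changes only the intersection of a family, so the
    families with a given reduced family H span a subcomplex.  Such families
    correspond to the finite sets S of positive integers disjoint from the
    union of H.  The order-preserving bijection between all positive integers
    and those outside that union identifies this subcomplex with the chains on
    the full simplex, the term of S being multiplied by (-1)^|S| to absorb the
    difference of signs between the two differentials. *)

(** * Order-preserving relabelling onto the complement of a finite set *)

Section Relabel.

Lemma bump_gt0 (a x : pnat) : (0 < bump (val a) (val x))%N.
Proof. by rewrite /bump; case: x => x /= x0; lia. Qed.

Lemma unbump_gt0 (a x : pnat) : (0 < unbump (val a) (val x))%N.
Proof. by rewrite /unbump; case: x a => [x /= x0] [a /= a0]; lia. Qed.

Definition pbump (a x : pnat) : pnat := Sub _ (bump_gt0 a x).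
Definition punbump (a x : pnat) : pnat := Sub _ (unbump_gt0 a x).

(* Induction on U: to avoid one more element, compose with a bump at its label. *)
Lemma relabel_exists (U : {fset pnat}) :
  {p : (pnat -> pnat) * (pnat -> pnat) | [/\
    forall x y, (val (p.1 x) < val (p.1 y))%N = (val x < val y)%N,
    cancel p.1 p.2,
    forall x, p.1 x \notin U &
    forall y, y \notin U -> p.1 (p.2 y) = y]}.
Proof.
apply: cid; elim/finSet_rect: U => U IH.
have [->|[u uU]] := fset_0Vmem U; first by exists (id, id).
have [[f g] /= [fmono fK fU gK]] := IH _ (fproperD1 uU).
have gu : f (g u) = u by rewrite gK // !inE eqxx.
exists (f \o pbump (g u), punbump (g u) \o g); split => /= [x y|x|x|y yU].
- by rewrite fmono /= /bump; lia.
- by rewrite /= fK; apply: val_inj; rewrite /= bumpK.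
- have := fU (pbump (g u) x); rewrite !inE negb_and => /orP[|//].
  rewrite negbK => /eqP /(congr1 g); rewrite fK => /(congr1 val) /=.
  by move=> h; have := neq_bump (val (g u)) (val x); rewrite h eqxx.
- have yU1 : y \notin U `\ u by rewrite !inE (negbTE yU) andbF.
  have [ygu|ygu] := eqVneq (g y) (g u).
    by move: yU; rewrite -(gK _ yU1) ygu gu uU.
  rewrite -[RHS](gK _ yU1); congr f; apply: val_inj => /=.
  by rewrite unbumpK // inE (inj_eq val_inj).
Qed.

Definition relabel U := (sval (relabel_exists U)).1.
Definition unlabel U := (sval (relabel_exists U)).2.

Variable U : {fset pnat}.
Implicit Types s S : {fset pnat}.

Lemma relabel_lt x y :
  (val (relabel U x) < val (relabel U y))%N = (val x < val y)%N.
Proof. by rewrite /relabel; case: (svalP (relabel_exists U)). Qed.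

Lemma relabelK : cancel (relabel U) (unlabel U).
Proof. by rewrite /relabel /unlabel; case: (svalP (relabel_exists U)). Qed.

Lemma relabel_notin x : relabel U x \notin U.
Proof. by rewrite /relabel; case: (svalP (relabel_exists U)). Qed.

Lemma unlabelK y : y \notin U -> relabel U (unlabel U y) = y.
Proof.
by move=> yU; rewrite /relabel /unlabel; case: (svalP (relabel_exists U)) => _ _ _ ->.
Qed.

Lemma relabel_inj : injective (relabel U).
Proof. exact: can_inj relabelK. Qed.

Lemma relabel_imfsetK s : unlabel U @` (relabel U @` s) = s.
Proof.
rewrite -imfset_comp -[RHS]imfset_id; apply: eq_imfset => // x /=.
exact: relabelK.
Qed.

Lemma unlabel_imfsetK S :
  {in S, forall x, x \notin U} -> relabel U @` (unlabel U @` S) = S.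
Proof.
move=> SU; rewrite -imfset_comp -[RHS]imfset_id.
by apply: eq_in_imfset => x /= /SU; apply: unlabelK.
Qed.

Lemma card_relabel s : #|` relabel U @` s| = #|` s|.
Proof. by rewrite card_imfset //; apply: relabel_inj. Qed.

Lemma relabel_fsetD1 s x : (relabel U @` s) `\ relabel U x = relabel U @` (s `\ x).
Proof.
apply/fsetP => y; rewrite in_fsetD1; apply/andP/imfsetP => /=.
  move=> [yx /imfsetP[/= z zs yz]]; exists z => //; rewrite !inE zs andbT.
  by apply: contra yx => /eqP <-; rewrite yz.
case=> z; rewrite !inE => /andP[zx zs] ->; split; last exact: in_imfset.
by rewrite (inj_eq relabel_inj).
Qed.

(** Positions depend only on the order, which [relabel] preserves; hence the signs of [delta_basis]
    and [simplex_boundary] can be compared. *)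
Lemma rank_relabel s x : rank (relabel U @` s) (relabel U x) = rank s x.
Proof.
rewrite /rank -[RHS]card_relabel; congr (#|` _|); apply/fsetP => y.
rewrite !inE; apply/andP/imfsetP => /=.
  move=> [/imfsetP[/= z zs ->]]; rewrite relabel_lt => zx.
  by exists z; rewrite // !inE zs.
case=> z; rewrite !inE => /andP[zs zx] ->; rewrite relabel_lt; split => //.
exact: in_imfset.
Qed.

End Relabel.

(** * Linear maps determined by their values on a basis *)

Lemma malgUZ (K : choiceType) (c : rat) (k : K) :
  << c *g k >> = c *: << k >> :> {malg rat[K]}.
Proof. by apply/malgP => k'; rewrite mcoeffZ !mcoeffU mulrnAr mulr1. Qed.

Lemma linear_malg_sum (K : choiceType) (V : lmodType rat)
    (f : {linear {malg rat[K]} -> V}) g :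
  f g = \sum_(k <- msupp g) g@_k *: f << k >>.
Proof.
rewrite [in LHS](monalgE g) linear_sum; apply: eq_bigr => k _ /=.
by rewrite malgUZ linearZ.
Qed.

Lemma eq_linear_basis (K : choiceType) (V : lmodType rat)
    (f g : {linear {malg rat[K]} -> V}) :
  (forall k, f << k >> = g << k >>) -> f =1 g.
Proof.
by move=> fg x; rewrite !linear_malg_sum; apply: eq_bigr => k _; rewrite fg.
Qed.

Lemma basis_vec_val (T : choiceType) (P : pred T) (u : {x : T | P x}) :
  basis_vec P (val u) = << u >>.
Proof. by rewrite /basis_vec valK. Qed.

Lemma free_on_linear_ext (T : choiceType) (P : pred T) (V : lmodType rat)
    (f g : {linear free_on P -> V}) :
  (forall x, P x -> f (basis_vec P x) = g (basis_vec P x)) -> f =1 g.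
Proof.
move=> fg; apply: eq_linear_basis => u.
by rewrite -basis_vec_val; apply/fg/valP.
Qed.

(** * Families with a prescribed reduced family *)

Section Families.
Implicit Types (L H : {fset {fset pnat}}) (l h s S : {fset pnat}).

Definition carrier H : {fset pnat} := \bigcup_(h <- H) h.

Lemma carrierP H x :
  reflect (exists2 h, h \in H & x \in h) (x \in carrier H).
Proof.
apply: (iffP (bigfcupP _ _ _ _)) => -[h].
  by rewrite andbT => hH xh; exists h.
by move=> hH xh; exists h; rewrite ?hH.
Qed.

Lemma core_disjoint_hat L x : x \in core L -> x \notin carrier (hat L).
Proof.
move=> xL; apply/carrierP => -[h /imfsetP[/= l _ ->]].
by rewrite inE xL.
Qed.

(** A point common to all sets [l] minus [core L] would lie in every [l], hence in [core L], which
    has been removed. *)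
Lemma core_hat L : L != fset0 -> core (hat L) = fset0.
Proof.
move=> L0; apply/fsetP => x; rewrite [RHS]inE; apply/negbTE/negP => xc.
have xh := (coreP _ (hat_neq0 L0) xc).
have : x \in core L.
  apply/(coreP _ L0) => l lL.
  have /xh : l `\` core L \in hat L by apply: in_imfset.
  by rewrite inE => /andP[].
move/core_disjoint_hat/negP; apply; apply/carrierP.
by case/fset0Pn: (hat_neq0 L0) => h hL; exists h; rewrite ?xh.
Qed.

Lemma uniform_hat q L : uniform q L -> uniform (q - #|` core L|%:Z) (hat L).
Proof.
move=> /allP qL; apply/allP => _ /imfsetP[/= l lL ->].
have /eqP <- := qL _ lL; rewrite cardfsD (fsetIidPr (core_sub lL)).
by rewrite -subzn //; apply: fsubset_leq_card (core_sub lL).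
Qed.

Section CoreFree.
Variables (H : {fset {fset pnat}}) (i : nat).
Hypotheses (H0 : H != fset0) (Hi : uniform i H) (Hc : core H = fset0).

(** A common point outside [S] would lie in every member of [H], whose intersection is empty. *)
Lemma core_free_family S : {in S, forall x, x \notin carrier H} ->
  core (family_of S H) = S.
Proof.
move=> SH; have F0 := family_of_neq0 S H0.
apply/fsetP => x; apply/(coreP _ F0)/idP => [xF|xS _ /imfsetP[/= h _ ->]].
  apply: contraT => xS; suff : x \in core H by rewrite Hc inE.
  apply/(coreP _ H0) => h hH; have := xF _ (in_imfset _ (fsetU S) hH).
  by rewrite inE (negbTE xS).
by rewrite inE xS.
Qed.

Lemma hat_free_family S : {in S, forall x, x \notin carrier H} ->
  hat (family_of S H) = H.
Proof.
move=> SH; rewrite /hat (core_free_family SH) -imfset_comp.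
rewrite -[RHS]imfset_id; apply: eq_in_imfset => h /= hH.
rewrite fsetDUl fsetDv fset0U; apply/fsetP => x; rewrite inE.
case: (boolP (x \in h)) => xh; rewrite ?andbF // andbT.
apply/negP => /SH/negP; apply; apply/carrierP; by exists h.
Qed.

Lemma is_index_free_family q S : {in S, forall x, x \notin carrier H} ->
  is_index q (family_of S H) = (#|` S|%:Z + i%:Z == q).
Proof.
move=> SH; rewrite /is_index family_of_neq0 //=.
have cF h : h \in H -> #|` S `|` h|%:Z = #|` S|%:Z + i%:Z.
  move=> hH; have /eqP <- := allP Hi _ hH.
  rewrite cardfsU; have -> : S `&` h = fset0; last by rewrite cardfs0 subn0 PoszD.
  apply/fsetP => x; rewrite !inE; apply/negbTE/negP => /andP[/SH/negP xS xh].
  by apply: xS; apply/carrierP; exists h.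
apply/allP/idP => [|Sq _ /imfsetP[/= h hH ->]]; last by rewrite cF.
case/fset0Pn: H0 => h hH /(_ _ (in_imfset _ (fsetU S) hH)).
by rewrite cF.
Qed.

Definition relabelled_family s := family_of (relabel (carrier H) @` s) H.

Lemma relabel_avoids s : {in relabel (carrier H) @` s, forall x, x \notin carrier H}.
Proof. by move=> x /imfsetP[/= y _ ->]; apply: relabel_notin. Qed.

(** Since [core L] avoids the carrier of [hat L], it is in the range of the relabelling, and
    [family_of_core_hat] rebuilds [L]. *)
Lemma hatP L : L != fset0 -> hat L = H -> exists s, L = relabelled_family s.
Proof.
move=> L0 LH; exists (unlabel (carrier H) @` core L).
rewrite /relabelled_family unlabel_imfsetK -?LH ?family_of_core_hat // => x.
exact: core_disjoint_hat.
Qed.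

(** A set of k vertices has dimension k - 1 but gives a family of degree k + i, because [S] and each
    member of [H] are disjoint; this is the shift by i + 1. *)
Lemma is_index_relabelled q s :
  is_index q (relabelled_family s) = is_simplex (q - i.+1%:Z) s.
Proof.
rewrite is_index_free_family; last exact: relabel_avoids.
by rewrite card_relabel /is_simplex; lia.
Qed.

Lemma core_relabelled s :
  core (relabelled_family s) = relabel (carrier H) @` s.
Proof. exact/core_free_family/relabel_avoids. Qed.

Lemma hat_relabelled s : hat (relabelled_family s) = H.
Proof. exact/hat_free_family/relabel_avoids. Qed.

End CoreFree.

(** * Projection to the summand of one reduced family, and its section *)

Section Component.
Variables (i : nat) (H : {fset {fset pnat}}).

(* The sign turns the coefficient (-1)^(rank + 1) of delta into the
   coefficient (-1)^rank of the simplicial boundary. *)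
Definition component_basis (q : int) L : free_on (is_simplex (q - i.+1%:Z)) :=
  if hat L == H then
    (-1) ^+ #|` core L| *: basis_vec _ (unlabel (carrier H) @` core L)
  else 0.

Definition component (q : int) :
    {linear free_on (is_index q) -> free_on (is_simplex (q - i.+1%:Z))} :=
  lin_ext (fun u : {L | is_index q L} => component_basis q (val u)).

Definition section_basis (q : int) s : free_on (is_index q) :=
  (-1) ^+ #|` s| *: basis_vec _ (relabelled_family H s).

Definition component_section (q : int) :
    {linear free_on (is_simplex (q - i.+1%:Z)) -> free_on (is_index q)} :=
  lin_ext (fun u : {s | is_simplex (q - i.+1%:Z) s} => section_basis q (val u)).

Lemma component_vec q L : is_index q L ->
  component q (basis_vec _ L) = component_basis q L.
Proof. exact: (lin_ext_basis_vec (component_basis q)). Qed.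

Lemma component_section_vec q s : is_simplex (q - i.+1%:Z) s ->
  component_section q (basis_vec _ s) = section_basis q s.
Proof. exact: (lin_ext_basis_vec (section_basis q)). Qed.

End Component.

Lemma component_sectionK (i : nat) H q w : H != fset0 -> uniform i H -> core H = fset0 ->
  component i H q (component_section i H q w) = w.
Proof.
move=> H0 Hi Hc.
apply: (free_on_linear_ext (f := component i H q \o component_section i H q)
  (g := idfun)) => s hs /=.
rewrite component_section_vec // /section_basis linearZ /=.
rewrite component_vec ?(is_index_relabelled H0 Hi) //.
rewrite /component_basis hat_relabelled // eqxx core_relabelled //.
(* The projection and the section carry the same sign, whose square is 1. *)
rewrite card_relabel relabel_imfsetK scalerA -expr2 -exprM mulnC exprM.
by rewrite sqrrN !expr1n scale1r.
Qed.

(** Every family in the image of the section has reduced family [H], so the test against [H']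
    fails. *)
Lemma component_section_neq (i : nat) H i' H' q w :
  H != fset0 -> uniform i H -> core H = fset0 -> H != H' ->
  component i' H' q (component_section i H q w) = 0.
Proof.
move=> H0 Hi Hc HH'.
apply: (free_on_linear_ext (f := component i' H' q \o component_section i H q)
  (g := \0)) => s hs /=.
rewrite component_section_vec // /section_basis linearZ /=.
rewrite component_vec ?(is_index_relabelled H0 Hi) //.
by rewrite /component_basis hat_relabelled // (negbTE HH') scaler0.
Qed.

Lemma section_component (i : nat) H q L :
  H != fset0 -> uniform i H -> core H = fset0 -> is_index q L ->
  component_section i H q (component i H q (basis_vec _ L)) =
  if hat L == H then basis_vec _ L else 0.
Proof.
move=> H0 Hi Hc Lq; rewrite component_vec // /component_basis.
case: eqP => [LH|_]; last by rewrite linear0.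
have [s LE] : exists s, L = relabelled_family H s.
  by apply: hatP; first by case/andP: Lq.
move: Lq; rewrite LE (is_index_relabelled H0 Hi) => sq.
rewrite core_relabelled // card_relabel relabel_imfsetK linearZ /=.
rewrite component_section_vec // /section_basis scalerA -expr2 -exprM mulnC.
by rewrite exprM sqrrN !expr1n scale1r.
Qed.

(** By [section_component] the composite is the projection onto the span of the families reducing to
    [H], so one component determines all coefficients there; injectivity rests on this. *)
Lemma component_coeff (i : nat) H q g (u : {L | is_index q L}) :
  H != fset0 -> uniform i H -> core H = fset0 -> hat (val u) = H ->
  (component_section i H q (component i H q g))@_u = g@_u.
Proof.
move=> H0 Hi Hc uH.
have sc (v : {L | is_index q L}) :
    component_section i H q (component i H q << v >>) =
    if hat (val v) == H then << v >> else 0 :> {malg rat[_]}.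
  by rewrite -basis_vec_val; apply: section_component => //; apply: valP.
have -> : component_section i H q (component i H q g) =
    \sum_(v <- msupp g) g@_v *: (if hat (val v) == H then << v >> else 0)
    :> {malg rat[_]}.
  rewrite [component i H q g]linear_malg_sum linear_sum.
  by apply: eq_bigr => v _; rewrite linearZ; congr (_ *: _); apply: sc.
rewrite [in RHS](monalgE g) !raddf_sum; apply: eq_bigr => v _ /=.
case: eqP => [_|vH]; first by rewrite -malgUZ.
rewrite mcoeffZ mcoeff0 mulr0 mcoeffU.
by case: eqP => [vu|_]; [case: vH; rewrite vu | rewrite mulr0n].
Qed.

Lemma component_diff (i : nat) H m n x :
  H != fset0 -> uniform i H -> core H = fset0 ->
  component i H n (cdiff frakA m n x) =
  cdiff (shiftC simplex_complex i.+1) m n (component i H m x).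
Proof.
move=> H0 Hi Hc.
have [mn|mn] := eqVneq m (n + 1); last first.
  have -> : cdiff frakA m n x = 0 by apply: cdiff_shape.
  rewrite linear0; apply/esym.
  by apply: (cdiff_shape (c := shiftC simplex_complex i.+1)).
subst m.
apply: (free_on_linear_ext (f := component i H n \o cdiff frakA (n + 1) n)
  (g := cdiff (shiftC simplex_complex i.+1) (n + 1) n \o component i H (n + 1))).
move=> L Ln /=; have L0 : L != fset0 by case/andP: Ln.
rewrite (lin_ext_basis_vec (delta_basis n)) // component_vec //.
rewrite /delta_basis linear_sum big_seq.
(* All terms of delta keep the reduced family [hat L], so a single test [hat L == H] decides the
   whole sum. *)
under eq_bigr => y yL.
  rewrite linearZ /= component_vec ?is_index_family_of // /component_basis.
  rewrite hat_family_of ?core_family_of ?fsubsetDl //.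
  over.
rewrite -big_seq /component_basis.
case: eqP => [LH|_]; last first.
  by rewrite linear0 big1 // => y _; rewrite scaler0.
have [s LE] := hatP L0 LH.
rewrite linearZ /=.
move: Ln; rewrite LE (is_index_relabelled H0 Hi) // core_relabelled // => sn.
rewrite card_relabel relabel_imfsetK.
rewrite (lin_ext_basis_vec (simplex_boundary (n - i.+1%:Z))) //.
rewrite big_imfset /=; last by move=> y z _ _; apply: relabel_inj.
rewrite /simplex_boundary [RHS]scaler_sumr; apply: eq_big_seq => y ys.
rewrite rank_relabel relabel_fsetD1 card_relabel relabel_imfsetK !scalerA.
(* Removing [y] flips the sign of the component, which cancels the extra -1 in the exponent
   [rank + 1] of delta. *)
have -> : #|` s| = #|` s `\ y|.+1 by rewrite (cardfsD1 y s) ys.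
by rewrite !exprS !mulN1r !mulNr [X in (- X) *: _]mulrC.
Qed.

End Families.

(** * Reduced families as elements of [scrE] *)

Lemma scrEP (i : nat) (L : scrE i) :
  [/\ val L != fset0, uniform i (val L) & core (val L) = fset0].
Proof. by have /and3P[? ? /eqP ?] := valP L. Qed.

Lemma uniform_inj (m n : int) (L : {fset {fset pnat}}) :
  L != fset0 -> uniform m L -> uniform n L -> m = n.
Proof. by move=> L0 mL nL; apply: (@is_index_inj _ _ L); apply/andP. Qed.

Lemma uniform_hat_nat (q : int) L : is_index q L ->
  exists i : nat, uniform i (hat L).
Proof.
move=> /andP[L0 /uniform_hat qL]; exists `|q - #|` core L|%:Z|%N.
(* The integer inside the absolute value is the cardinality of a member of [hat L], hence
   non-negative. *)
case/fset0Pn: (hat_neq0 L0) => h hL; have /allP/(_ _ hL)/eqP hq := qL.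
by move: qL; rewrite -hq absz_nat.
Qed.

Lemma hat_scrE (q : int) L : is_index q L ->
  exists i (M : scrE i), val M = hat L.
Proof.
move=> Lq; have L0 : L != fset0 by case/andP: Lq.
have [i iL] := uniform_hat_nat Lq.
have LP : [&& hat L != fset0, uniform i (hat L) & core (hat L) == fset0].
  by rewrite hat_neq0 // iL core_hat ?eqxx.
by exists i, (exist _ (hat L) LP).
Qed.

(** * Assembling the components into an isomorphism in each degree *)

Section Decomposition.
Variable q : int.
Implicit Types (g : free_on (is_index q)) (i : nat).

Lemma component_eq0 i H g :
  H \notin [seq hat (val u) | u <- msupp g] -> component i H q g = 0.
Proof.
move=> Hg; rewrite linear_malg_sum big_seq big1 // => u ug.
rewrite -basis_vec_val component_vec; last exact: valP.
rewrite /component_basis; case: eqP => [uH|_]; last exact: scaler0.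
by case/negP: Hg; rewrite -uH; apply: map_f.
Qed.

Lemma component_fin i g : exists s : seq (scrE i), forall L, L \notin s ->
  component i (val L) q g = 0.
Proof.
exists (pmap insub [seq hat (val u) | u <- msupp g]) => L Ls.
by apply: component_eq0; rewrite -mem_pmap_sub.
Qed.

Definition components_at i g :
    dsum (fun _ : scrE i => free_on (is_simplex (q - i.+1%:Z))) :=
  DSum (component_fin i g).

Lemma components_at_fin g :
  exists s : seq nat, forall i, i \notin s -> components_at i g = 0.
Proof.
(* A non-zero component at level [i] comes from a reduced family of the support of [g] whose members
   have [i] elements; only finitely many sizes occur. *)
pose deg (H : {fset {fset pnat}}) := [seq #|` h| | h <- H].
exists (flatten [seq deg (hat (val u)) | u <- msupp g]) => i iNs.
apply: dsumP => L /=; apply: component_eq0; apply: contra iNs.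
move=> /mapP[u ug LE]; apply/flatten_mapP; exists u => //.
have [L0 Li _] := scrEP L; case/fset0Pn: L0 => h hL.
have /eqP[<-] := allP Li _ hL.
by rewrite /deg -LE; apply: (map_f (fun h : {fset pnat} => #|` h|)).
Qed.

Definition components g :
    dsum (fun i => dsum (fun _ : scrE i => free_on (is_simplex (q - i.+1%:Z)))) :=
  DSum (components_at_fin g).

Fact components_linear : linear components.
Proof. by move=> a g h; do 2![apply: dsumP => ?] => /=; rewrite linearP. Qed.

HB.instance Definition _ :=
  GRing.isLinear.Build rat (free_on (is_index q)) _ *:%R components
    components_linear.

Lemma components_inj : injective components.
Proof.
move=> g h gh; apply/malgP => u.
have [i [L LE]] := hat_scrE (valP u); have [L0 Li Lc] := scrEP L.
rewrite -(component_coeff g L0 Li Lc (esym LE)).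
rewrite -(component_coeff h L0 Li Lc (esym LE)).
by rewrite -[component i (val L) q g]/(components g i L) gh.
Qed.

(** The preimage is the sum of the sections of all entries of [w]; the component at [L] kills every
    summand except the one from [L]. *)
Lemma components_surj w : exists g, components g = w.
Proof.
have [s sP] := dsum_fin w.
(* Choice picks the finite inner supports for all levels at once. *)
have [t tP] : {t : forall i, seq (scrE i) | forall i L, L \notin t i -> w i L = 0}.
  by exists (fun i => sval (cid (dsum_fin (w i)))) => i; case: cid.
pose back i (L : scrE i) := component_section i (val L) q (w i L).
exists (\sum_(i <- undup s) \sum_(L <- undup (t i)) back i L).
apply: dsumP => i; apply: dsumP => L /=.
have [L0 Li Lc] := scrEP L.
have other j (M : scrE j) : val M != val L -> component i (val L) q (back j M) = 0.
  by have [M0 Mj Mc] := scrEP M => ML; apply: component_section_neq.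
have same : component i (val L) q (back i L) = w i L by apply: component_sectionK.
have level j : component i (val L) q (\sum_(M <- undup (t j)) back j M) =
    if j == i then w i L else 0.
  rewrite linear_sum; case: eqP => [->|ji]; last first.
    (* A non-empty family has members of only one size, so families from different levels are
       distinct. *)
    rewrite big1 // => M _; apply: other; apply: contra_notN ji => /eqP ML.
    have [M0 Mj _] := scrEP M; have := uniform_inj L0 Li.
    by rewrite -ML => /(_ _ Mj) [].
  have [Lt|Lt] := boolP (L \in t i); last first.
    rewrite (tP _ _ Lt) big1_seq // => M; rewrite mem_undup => /= Mt.
    by apply: other; rewrite (inj_eq val_inj); apply: contraNneq Lt => <-.
  have Lu : L \in undup (t i) by rewrite mem_undup.
  rewrite [LHS](bigD1_seq L Lu (undup_uniq _)).
  apply: etrans (addr0 _); apply: congr2; first exact: same.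
  apply: big1 => M ML.
  by apply: other; rewrite (inj_eq val_inj).
rewrite linear_sum (eq_bigr _ (fun j _ => level j)).
have [si|si] := boolP (i \in s); last first.
  rewrite (sP _ si) big1_seq //= => j; rewrite mem_undup => /= js.
  by case: eqP => // ji; move: si; rewrite -ji js.
have iu : i \in undup s by rewrite mem_undup.
rewrite [LHS](bigD1_seq i iu (undup_uniq _)) eqxx.
apply: etrans (addr0 _); apply: congr2; first by [].
by apply: big1 => j /negbTE ->.
Qed.

Lemma components_bij : bijective components.
Proof.
exists (fun w => sval (cid (components_surj w))) => [g|w]; last by case: cid.
by apply: components_inj; case: cid.
Qed.

End Decomposition.

Theorem theorem5p5 :
  complex_iso frakA
    (dsum_complex (fun i : nat =>
      dsum_complex (fun L : scrE i => shiftC simplex_complex (i.+1)%:Z))).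
Proof.
exists (fun q => @components q : {linear _ -> _}); split=> [q|m n x].
  exact: components_bij.
(* The differential of the direct sum acts entrywise, so commutation is checked at each [i] and
   [L]. *)
apply: dsumP => i; apply: dsumP => L; have [L0 Li Lc] := scrEP L.
exact: component_diff.
Qed.
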